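(* Let $R$ be a ring. Then $R$ is Yaqub nil-clean if and only if (1) $R$ is an exchange ring; and (2) $R$ is a Hirano ring.
   Context: All rings are associative with identity, not necessarily commutative. $U(R)$ denotes the group of units of $R$. A ring $R$ is Yaqub nil-clean if for every $a\in R$, $a+a^3$ is nilpotent or $a-a^3$ is nilpotent. A ring $R$ is an exchange ring if for any $a\in R$ there exists an idempotent $e\in R$ such that $e\in aR$ and $1-e\in (1-a)R$. A ring $R$ is a Hirano ring if for every $u\in U(R)$, $1+u^2$ is nilpotent or $1-u^2$ is nilpotent. *)

(* Defs.v *)
From HB Require Import structures.
From mathcomp Require Import all_boot all_algebra.
Set Implicit Arguments.
Unset Strict Implicit.
Unset Printing Implicit Defensive.
Import GRing.Theory.
Local Open Scope ring_scope.

(* Rings are [pzRingType]s: not necessarily commutative, and 1 = 0 is allowed.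
   [GRing.unit] is not available at that level (it requires a [unitRingType],
   hence 1 != 0), so U(R) is spelled out as a predicate. *)
Definition is_unit (R : pzRingType) (u : R) : Prop :=
  exists v : R, u * v = 1 /\ v * u = 1.

Definition is_nilpotent (R : pzRingType) (x : R) : Prop :=
  exists n : nat, x ^+ n = 0.

Definition is_idempotent (R : pzRingType) (e : R) : Prop := e * e = e.

(* e \in aR *)
Definition in_right_ideal (R : pzRingType) (a e : R) : Prop :=
  exists r : R, e = a * r.

Definition yaqub_nil_clean (R : pzRingType) : Prop :=
  forall a : R, is_nilpotent (a + a ^+ 3) \/ is_nilpotent (a - a ^+ 3).

Definition exchange_ring (R : pzRingType) : Prop :=
  forall a : R, exists e : R,
    [/\ is_idempotent e, in_right_ideal a e & in_right_ideal (1 - a) (1 - e)].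

Definition hirano_ring (R : pzRingType) : Prop :=
  forall u : R, is_unit u ->
    is_nilpotent (1 + u ^+ 2) \/ is_nilpotent (1 - u ^+ 2).

(* Main.v *)
Require Import Defs.
From HB Require Import structures.
From mathcomp Require Import all_boot all_algebra ring.
Set Implicit Arguments. Unset Strict Implicit.
Import GRing.Theory. Local Open Scope ring_scope.

(** From left to right, each [a] satisfies [a * (1 - a * h)] nilpotent with
    [h] one of [a], [- a].  Such an [a] has a Fitting idempotent [e]: it commutes
    with [a], [a] is invertible on the [e] corner and nilpotent on the other one
    ([fitting]).  Since [1 - a] is invertible where [a] is nilpotent, [e] is an
    exchange idempotent for [a].  For a unit, the factor [u] of [u +- u ^+ 3] can
    be cancelled.

    From right to left, it is enough to find for each [a] some [h] commuting with
    it such that [a * (1 - a * h)] is nilpotent: the Fitting idempotent [e] then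
    turns [a] into the unit [u = a * e + (1 - e)], and [1 +- u ^+ 2] and
    [1 +- a ^+ 2] agree on the [e] corner, while [a] is nilpotent on the other
    one.  The element [h] is found as follows.

    - In a Hirano ring, [p * q] is nilpotent for [p] in [e R (1 - e)] and [q] in
      [(1 - e) R e] ([corner_mul_nil]): such [p] and [q] multiply like
      off-diagonal 2 x 2 matrix entries, and the Hirano condition on two units
      built from them gives polynomial relations on [p * q + q * p] that have
      only 0 as a common root modulo nilpotents.
      Hence [e R (1 - e)] lies in the Jacobson radical J, so that idempotents are
      central modulo J ([idem_central_radical]).  Moreover J is nil, and [R] is
      Dedekind-finite.
    - Let [e] be an exchange idempotent for [a].  Then [a * e + (1 - e)] and, by
      symmetry, [1 - a * (1 - e)] are units ([corner_unit]).  Fourth powers of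
      units are unipotent, so that, modulo J, [a ^+ 4 - 1] is nilpotent
      on the [e] corner and [(1 - a) ^+ 4 - 1] on the other one.  Hence
      [(a ^+ 4 - 1) * ((1 - a) ^+ 4 - 1)] is nilpotent ([exchange_nil_pow4]).
    - For [a = 3] this product is 1200, so 30 is nilpotent; with this, [h] can
      be read off as an integer polynomial in [a].

    Relations between polynomials in a single element are transported from the
    commutative ring {poly int} by evaluation. *)

(** * Nilpotents, units and idempotents *)

Section RingFacts.
Variable R : pzRingType.
Implicit Types a b e g h j p q u v w x y z : R.

Lemma nil_mul_comm x y : GRing.comm x y -> is_nilpotent x -> is_nilpotent (x * y).
Proof. by move=> cxy [n xn0]; exists n; rewrite exprMn_comm // xn0 mul0r. Qed.

Lemma nil_opp x : is_nilpotent x -> is_nilpotent (- x).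
Proof. by case=> n xn0; exists n; rewrite exprNn xn0 mulr0. Qed.

Lemma nil_add_comm x y :
  GRing.comm x y -> is_nilpotent x -> is_nilpotent y -> is_nilpotent (x + y).
Proof.
move=> cxy [m xm0] [n yn0]; exists (m + n)%N.
rewrite exprDn_comm // big1 // => i _.
case: (leqP n i) => [le_ni | lt_in].
  by rewrite -(subnKC le_ni) exprD yn0 mul0r mulr0 mul0rn.
have le_m : (m <= m + n - i)%N by rewrite -addnBA ?leq_addr // ltnW.
by rewrite -(subnKC le_m) exprD xm0 !mul0r mul0rn.
Qed.

Lemma nil_root x n : is_nilpotent (x ^+ n.+1) -> is_nilpotent x.
Proof. by case=> m xm0; exists (n.+1 * m)%N; rewrite exprM. Qed.

Lemma nil_swap x y : is_nilpotent (x * y) -> is_nilpotent (y * x).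
Proof.
case=> n xyn0; exists n.+1.
have xyE k : (y * x) ^+ k.+1 = y * (x * y) ^+ k * x.
  elim: k => [|k IHk]; first by rewrite expr0 mulr1 expr1.
  by rewrite exprS IHk exprS !mulrA.
by rewrite xyE xyn0 mulr0 mul0r.
Qed.

Lemma unit_mul u v : is_unit u -> is_unit v -> is_unit (u * v).
Proof.
case=> u' [uu' u'u] [v' [vv' v'v]]; exists (v' * u'); split.
  by rewrite mulrA -[u * v * v']mulrA vv' mulr1.
by rewrite mulrA -[v' * u' * u]mulrA u'u mulr1.
Qed.

Lemma unit_1B_nil x : is_nilpotent x -> is_unit (1 - x).
Proof.
case=> n xn0; exists (\sum_(i < n) x ^+ i).
have E : (1 - x) * (\sum_(i < n) x ^+ i) = 1.
  by rewrite -opprB mulNr -subrX1 xn0 sub0r opprK.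
split=> //; rewrite -[RHS]E; apply/esym/commr_sum => i _.
by apply: commrX; apply/commr_sym/commrB; [exact: commr1 | exact: commr_refl].
Qed.

Lemma unit_1D_nil x : is_nilpotent x -> is_unit (1 + x).
Proof. by move=> nx; rewrite -[x]opprK; apply/unit_1B_nil/nil_opp. Qed.

Lemma nil_unit_cancel x u :
  GRing.comm x u -> is_unit u -> is_nilpotent (x * u) -> is_nilpotent x.
Proof.
move=> cxu [v [uv1 vu1]] [n]; rewrite exprMn_comm // => xun0; exists n.
have uvn : u ^+ n * v ^+ n = 1.
  by rewrite -exprMn_comm ?uv1 ?expr1n // /GRing.comm uv1 vu1.
by rewrite -[LHS]mulr1 -uvn mulrA xun0 mul0r.
Qed.

Lemma idem_compl e : is_idempotent e -> is_idempotent (1 - e).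
Proof.
by rewrite /is_idempotent => ee; rewrite mulrBl mul1r mulrBr mulr1 ee subrr subr0.
Qed.

Lemma idem_exp e n : is_idempotent e -> e ^+ n.+1 = e.
Proof. by move=> ee; elim: n => // n IHn; rewrite exprS IHn. Qed.

Lemma nil_split e x : is_idempotent e -> GRing.comm x e ->
  is_nilpotent (x * e) -> is_nilpotent (x * (1 - e)) -> is_nilpotent x.
Proof.
move=> ee cxe [m xem] [n xfn].
have cxf : GRing.comm x (1 - e) by apply: commrB => //; exact: commr1.
have xe0 : x ^+ m.+1 * e = 0.
  by rewrite -[in e](@idem_exp e m) // -exprMn_comm // exprS xem mulr0.
have xf0 : x ^+ n.+1 * (1 - e) = 0.
  rewrite -[in LHS](@idem_exp (1 - e) n); last exact: idem_compl.
  by rewrite -exprMn_comm // exprS xfn mulr0.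
exists (m.+1 + n.+1)%N; rewrite -[LHS]mulr1 -[1](subrKC e) mulrDr.
by rewrite {1}addnC !exprD -!mulrA xe0 xf0 !mulr0 addr0.
Qed.

(** Expanding [(1 - a * h) ^+ n] as [1 - a * g] gives [a ^+ n = a ^+ n.+1 * g],
    so that the powers of [a] stabilise and [a ^+ n * g ^+ n] is the idempotent
    that splits off the part on which [a] is invertible. *)
Lemma fitting a h : GRing.comm a h -> is_nilpotent (a * (1 - a * h)) ->
  exists e b, [/\ is_idempotent e, GRing.comm a e, a * b = e /\ b * a = e,
    b * e = b /\ e * b = b & is_nilpotent (a * (1 - e))].
Proof.
move=> cah [n].
have [g cag gE] : exists2 g, GRing.comm a g & (1 - a * h) ^+ n = 1 - a * g.
  elim: n => [|n [g cag gE]].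
    by exists 0; [exact: commr0 | rewrite mulr0 subr0].
  exists (h + g - h * a * g).
    by apply: commrB; [exact: commrD | do ?apply: commrM].
  rewrite exprS gE mulrBl mul1r [in LHS]mulrBr mulr1 mulrBr mulrDr !mulrA.
  by rewrite !opprB opprD !addrA [RHS]addrAC; congr (_ - _); exact: addrAC.
rewrite exprMn_comm; last first.
  by apply: commrB; [exact: commr1 | apply: commrM => //; exact: commr_refl].
rewrite gE mulrBr mulr1 mulrA -exprSr => /eqP; rewrite subr_eq0 => /eqP anE.
have cg k l : GRing.comm (a ^+ k) (g ^+ l).
  by apply: commrX; apply/commr_sym/commrX/commr_sym.
have anI k : a ^+ n = a ^+ (n + k) * g ^+ k.
  elim: k => [|k IHk]; first by rewrite addn0 expr0 mulr1.
  rewrite {1}anE exprSr {1}IHk -!mulrA (_ : g ^+ k * (a * g) = a * g ^+ k.+1).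
    by rewrite mulrA -exprSr addnS.
  by rewrite mulrA -[g ^+ k * a](cg 1%N k) -mulrA -exprSr.
pose e := a ^+ n * g ^+ n.
have ane : a ^+ n * e = a ^+ n by rewrite /e mulrA -exprD -anI.
have cae : GRing.comm a e.
  apply: commrM; first by apply: commrX; exact: commr_refl.
  by apply: commrX.
have cge : GRing.comm g e.
  by apply: commrM; apply: commrX => //; apply: commr_sym.
have ee : is_idempotent e.
  by rewrite /is_idempotent {1}/e (cg n n) -mulrA ane -(cg n n).
have age : a * (g * e) = e.
  rewrite mulrA /e mulrA -(mulrA a) -[g * a ^+ n](cg n 1%N).
  by rewrite mulrA -exprS -anE.
exists e, (g * e); split=> //.
- by split=> //; rewrite -mulrA -cae mulrA -cag -mulrA.
- by split; [rewrite -mulrA ee | rewrite mulrA -cge -mulrA ee].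
exists n.+1; rewrite exprMn_comm; last by apply: commrB => //; exact: commr1.
rewrite (@idem_exp (1 - e)); last exact: idem_compl.
by rewrite exprS -mulrA mulrBr mulr1 ane subrr mulr0.
Qed.

(** On the [1 - e] corner of the Fitting decomposition [a] is nilpotent, hence
    [1 - a] is invertible there. *)
Lemma nil_exchange a h : GRing.comm a h -> is_nilpotent (a * (1 - a * h)) ->
  exists e, [/\ is_idempotent e, in_right_ideal a e & in_right_ideal (1 - a) (1 - e)].
Proof.
move=> cah /(fitting cah)[e [b [ee cae [abe _] _ /unit_1B_nil[w [ww _]]]]].
exists e; split=> //; first by exists b.
exists ((1 - e) * w).
have ff := idem_compl ee.
rewrite mulrA mulrBl mul1r.
have caf : GRing.comm a (1 - e) by apply: commrB => //; exact: commr1.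
have -> : 1 - e - a * (1 - e) = (1 - e) * (1 - a * (1 - e)).
  by rewrite [RHS]mulrBr mulr1 [in RHS]mulrA -caf -mulrA ff.
by rewrite -mulrA ww mulr1.
Qed.

(** * The Jacobson radical *)

(** The Jacobson radical, with the inverted elements in the symmetric form
    [1 + y * x * z]: stability under multiplication on both sides is then
    immediate. *)
Definition radical x := forall y z, is_unit (1 + y * x * z).

Lemma radicalMl x y : radical x -> radical (y * x).
Proof. by move=> Jx s t; rewrite mulrA. Qed.

Lemma radicalMr x y : radical x -> radical (x * y).
Proof. by move=> Jx s t; rewrite mulrA -mulrA. Qed.

(** The inverse of [1 + s * x * t] can be absorbed in the multiplier of [y]. *)
Lemma radicalD x y : radical x -> radical y -> radical (x + y).
Proof.
move=> Jx Jy s t; have [v [uv vu]] := Jx s t.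
rewrite mulrDr mulrDl addrA.
have -> : 1 + s * x * t + s * y * t = (1 + s * x * t) * (1 + v * s * y * t).
  by rewrite mulrDr mulr1 !mulrA uv mul1r.
by apply: unit_mul.
Qed.

Lemma radicalN x : radical x -> radical (- x).
Proof. by rewrite -mulN1r; apply: radicalMl. Qed.

Lemma radicalB x y : radical x -> radical y -> radical (x - y).
Proof. by move=> Jx Jy; apply: radicalD => //; apply: radicalN. Qed.

Lemma radical0 : radical 0.
Proof. by move=> s t; rewrite mulr0 mul0r addr0; exists 1; rewrite mulr1. Qed.

Lemma unit_1D_rad x : radical x -> is_unit (1 + x).
Proof. by move=> /(_ 1 1); rewrite mul1r mulr1. Qed.

Lemma unit_1B_rad x : radical x -> is_unit (1 - x).
Proof. by move/radicalN/unit_1D_rad. Qed.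

Lemma idem_radical_eq0 g : is_idempotent g -> radical g -> g = 0.
Proof.
move=> gg /unit_1B_rad[w [uw wu]].
by rewrite -[g]mul1r -wu -mulrA mulrBl mul1r gg subrr mulr0.
Qed.

(** * Yaqub nil-clean rings are exchange and Hirano rings *)

Lemma yaqub_exchange : yaqub_nil_clean R -> exchange_ring R.
Proof.
move=> Y a; case: (Y a) => na.
  apply: (@nil_exchange a (- a)).
    by apply: commrN; exact: commr_refl.
  by rewrite mulrN opprK mulrDr mulr1 -expr2 -exprS.
apply: (@nil_exchange a a); first exact: commr_refl.
by rewrite mulrBr mulr1 -expr2 -exprS.
Qed.

Lemma yaqub_hirano : yaqub_nil_clean R -> hirano_ring R.
Proof.
move=> Y u uu.
have cu s : GRing.comm (1 + s * u ^+ 2) u -> is_nilpotent (u + s * u ^+ 3) ->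
    is_nilpotent (1 + s * u ^+ 2).
  by move=> c; rewrite exprSr mulrA -[X in X + _]mul1r -mulrDl; apply: nil_unit_cancel.
case: (Y u) => nu; [left; have := cu 1 | right; have := cu (-1)];
  rewrite ?mulN1r ?mul1r; apply=> //; apply/commr_sym.
  by apply: commrD; [exact: commr1 | apply: commrX; exact: commr_refl].
by apply: commrB; [exact: commr1 | apply: commrX; exact: commr_refl].
Qed.

End RingFacts.

(** * Evaluation of integer polynomials *)

Section IntegerPolynomials.
Variable R : nzRingType.
Implicit Types a e u v x y : R.

Definition ev a : {rmorphism {poly int} -> R} := horner_morph (commr_int a).

Lemma evX a : ev a 'X = a.
Proof. exact: horner_morphX. Qed.

Lemma evC a c : ev a c%:P = c%:~R.
Proof. exact: horner_morphC. Qed.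

Lemma ev_comm a p q : GRing.comm (ev a p) (ev a q).
Proof. by rewrite /GRing.comm -!rmorphM mulrC. Qed.

Lemma comm_ev x a p : GRing.comm x a -> GRing.comm x (ev a p).
Proof.
move=> cxa; elim/poly_ind: p => [|p c IHp]; first by rewrite rmorph0; exact: commr0.
rewrite rmorphD rmorphM /= evX evC.
by apply: commrD; [exact: commrM | exact: commr_int].
Qed.

(** The set of integer polynomials whose value at [a] is nilpotent is a radical
    ideal of a commutative ring; nilpotency of expressions in [a] is derived by
    calculating in it. *)
Definition nilev a : {poly int} -> Prop := fun p => is_nilpotent (ev a p).

Lemma nilevM a p q : nilev a p -> nilev a (p * q).
Proof.
by move=> np; rewrite /nilev rmorphM; apply: nil_mul_comm => //; exact: ev_comm.
Qed.

Lemma nilevMl a p q : nilev a p -> nilev a (q * p).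
Proof. by rewrite mulrC; exact: nilevM. Qed.

Lemma nilevD a p q : nilev a p -> nilev a q -> nilev a (p + q).
Proof.
by move=> np nq; rewrite /nilev rmorphD; apply: nil_add_comm => //; exact: ev_comm.
Qed.

Lemma nilevB a p q : nilev a p -> nilev a q -> nilev a (p - q).
Proof.
by move=> np nq; apply: nilevD => //; rewrite /nilev rmorphN; apply: nil_opp.
Qed.

Lemma nilev_root a p n : nilev a (p ^+ n.+1) -> nilev a p.
Proof. by rewrite /nilev rmorphXn; exact: nil_root. Qed.

Lemma nilev_cancel a p q : is_unit (ev a q) -> nilev a (p * q) -> nilev a p.
Proof.
by move=> uq; rewrite /nilev rmorphM; apply: nil_unit_cancel => //; exact: ev_comm.
Qed.

(** An element that agrees with [y] on [e] has the same polynomials as [y] on [e],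
    modulo J, as soon as [e] commutes with [y] modulo J: this moves a polynomial
    relation from a unit to the element that it was built from. *)
Lemma ev_transfer e x y p : radical (y * e - e * y) -> x * e = y * e ->
  radical ((ev x p - ev y p) * e).
Proof.
move=> Jye xye; elim/poly_ind: p => [|p c IHp].
  by rewrite !rmorph0 subrr mul0r; exact: radical0.
rewrite !rmorphD !rmorphM /= !evX !evC opprD addrACA subrr addr0 mulrBl -!mulrA xye -mulrBl.
rewrite -[y * e](subrK (e * y)) mulrDr.
apply: radicalD; first exact: radicalMl.
by rewrite mulrA; exact: radicalMr.
Qed.

End IntegerPolynomials.

(** * Hirano rings *)

Section HiranoRings.
Variable R : nzRingType.
Hypothesis HR : hirano_ring R.
Implicit Types a b e g h j p q r u v w x y z : R.

Lemma unit_pow4 u : is_unit u -> is_nilpotent (u ^+ 4 - 1).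
Proof.
move=> /HR uP; suff : nilev u ('X^4 - 1).
  by rewrite /nilev rmorphB rmorphXn rmorph1 /= evX.
have E : 'X^4 - 1 = (1 + 'X^2) * ('X^2 - 1) :> {poly int} by ring.
have E' : 'X^4 - 1 = (1 - 'X^2) * (- 1 - 'X^2) :> {poly int} by ring.
case: uP => nu; [rewrite E | rewrite E']; apply: nilevM; rewrite /nilev.
  by rewrite rmorphD rmorphXn rmorph1 /= evX.
by rewrite rmorphB rmorphXn rmorph1 /= evX.
Qed.

Lemma sqr_add_inv u w : u * w = 1 -> w * u = 1 ->
  (u + w) ^+ 2 = (w - u) * (w - u) + 4.
Proof.
move=> uw wu.
have -> : 4 = (1 + 1) + (1 + 1) :> R by rewrite -addrA.
rewrite expr2 [in LHS]mulrDl ![in LHS]mulrDr [in RHS]mulrBl ![in RHS]mulrBr uw wu opprB.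
rewrite [RHS]addrACA !addrA !subrK.
by rewrite [LHS]addrC !addrA; congr (_ + 1); exact: addrAC.
Qed.

(** The Hirano condition on [u], multiplied by the inverse [w] of [u]. *)
Lemma nil_add_or_sub_inv u w : u * w = 1 -> w * u = 1 ->
  is_nilpotent (u + w) \/ is_nilpotent (w - u).
Proof.
move=> uw wu.
have cw2 s : GRing.comm (1 + s * u ^+ 2) w -> is_nilpotent (1 + s * u ^+ 2) ->
    is_nilpotent (w + s * u).
  move=> c /(nil_mul_comm c); rewrite mulrDl mul1r -mulrA.
  by rewrite expr2 -[u * u * w]mulrA uw mulr1.
have c2 : GRing.comm w (u ^+ 2) by apply: commrX; rewrite /GRing.comm uw wu.
have uU : is_unit u by exists w.
case: (HR uU) => nu; [left; have := cw2 1 | right; have := cw2 (-1)].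
  rewrite !mul1r [w + u]addrC; apply => //.
  by apply/commr_sym/commrD => //; exact: commr1.
rewrite !mulN1r; apply => //.
by apply/commr_sym/commrB => //; exact: commr1.
Qed.

(** If [w - u] is nilpotent, so is [(w - u) ^+ 2 = (2 + z) ^+ 2 - 4 = z * (z + 4)];
    otherwise it is [z + 2] that is nilpotent. *)
Lemma nil_poly_of_add_inv u w z : u * w = 1 -> w * u = 1 -> u + w = 2 + z ->
  nilev z ('X * ('X + 2) * ('X + 4)).
Proof.
move=> uw wu uwz.
have zE : z = u + w - 2 by rewrite uwz addrAC subrr add0r.
case: (nil_add_or_sub_inv uw wu) => nwu.
  by rewrite mulrAC; apply: nilevMl; rewrite /nilev rmorphD /= evX rmorph_nat zE subrK.
rewrite mulrAC; apply: nilevM; rewrite /nilev.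
suff -> : ev z ('X * ('X + 4)) = (w - u) * (w - u).
  by apply: nil_mul_comm => //; exact: commr_refl.
have -> : 'X * ('X + 4) = ('X + 2) ^+ 2 - 4 :> {poly int} by ring.
rewrite rmorphB rmorphXn rmorphD /= evX !rmorph_nat zE subrK.
by rewrite (sqr_add_inv uw wu) addrK.
Qed.

Lemma nil_poly_of_sub_inv u w z : u * w = 1 -> w * u = 1 -> w - u = z ->
  nilev z ('X * ('X^2 + 4)).
Proof.
move=> uw wu wuz; have uU : is_unit u by exists w.
case: (nil_add_or_sub_inv uw wu) => [nwu|]; last by rewrite wuz => nz; apply: nilevM; rewrite /nilev evX.
apply: nilevMl; rewrite /nilev rmorphD rmorphXn /= evX rmorph_nat -wuz.
rewrite expr2 -(sqr_add_inv uw wu) expr2.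
by apply: nil_mul_comm => //; exact: commr_refl.
Qed.

(** The element [t = p * q + q * p] commutes with everything that [e], [p] and [q]
    generate.  The unit [(1 + p) * (1 + q)] plays the role of a 2 x 2 matrix of
    determinant 1 and trace [2 + t], and [(1 - 2 * e) * (1 + p) * (1 + q)] that of
    one of determinant -1 and trace [- t].  The resulting relations
    [t * (t + 2) * (t + 4)] and [t * (t ^+ 2 + 4)], together with the second
    one for [2 * t], which comes from doubling [q], leave only [t = 0] modulo
    nilpotents. *)
Lemma corner_mul_nil e p q : is_idempotent e -> e * p = p -> p * e = 0 ->
  q * e = q -> e * q = 0 -> is_nilpotent (p * q).
Proof.
move=> ee ep pe qe eq.
have pp : p * p = 0 by rewrite -{2}ep mulrA pe mul0r.
have qq : q * q = 0 by rewrite -{1}qe -mulrA eq mulr0.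
have inv1 x : x * x = 0 -> (1 + x) * (1 - x) = 1 /\ (1 - x) * (1 + x) = 1.
  by move=> xx; rewrite !mulrDl !mulrDr !mul1r !mulr1 !mulrN !mulNr xx !oppr0 !addr0 addrNK addrK.
have prodE x y : (1 + x) * (1 + y) = 1 + x * y + (x + y).
  by rewrite mulrDl mul1r mulrDr mulr1 [x + x * y]addrC addrACA [y + x]addrC.
have A : nilev (p * q + q * p) ('X * ('X + 2) * ('X + 4)).
  have [p1 p2] := inv1 p pp; have [q1 q2] := inv1 q qq.
  apply: (@nil_poly_of_add_inv ((1 + p) * (1 + q)) ((1 - q) * (1 - p))).
  - by rewrite mulrA -(mulrA (1 + p)) q1 mulr1.
  - by rewrite mulrA -(mulrA (1 - q)) p2 mulr1.
  by rewrite !prodE mulrNN -opprD [q + p]addrC addrACA subrr addr0 addrACA.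
have B r : r * e = r -> e * r = 0 -> nilev (p * r + r * p) ('X * ('X^2 + 4)).
  move=> re er.
  have rr : r * r = 0 by rewrite -{1}re -mulrA er mulr0.
  have [p1 p2] := inv1 p pp; have [r1 r2] := inv1 r rr.
  (* s is +1 or -1 on the two corners, so that it anticommutes with p and r. *)
  pose s := 1 - (e + e).
  have sl x : e * x = x -> s * x = - x.
    by move=> ex; rewrite mulrBl mul1r mulrDl ex opprD addrA subrr sub0r.
  have sl0 x : e * x = 0 -> s * x = x.
    by move=> ex; rewrite mulrBl mul1r mulrDl ex addr0 subr0.
  have ps : p * s = p by rewrite mulrBr mulr1 mulrDr pe addr0 subr0.
  have rs : r * s = - r by rewrite mulrBr mulr1 mulrDr re opprD addrA subrr sub0r.
  have ss : s * s = 1.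
    by rewrite {2}/s mulrBr mulr1 mulrDr (sl e ee) -opprD opprK subrK.
  apply: (@nil_poly_of_sub_inv (s * ((1 + p) * (1 + r))) ((1 - r) * (1 - p) * s)).
  - by rewrite mulrA -(mulrA s) -(mulrA (1 + p)) (mulrA (1 + r)) r1 mul1r p1 mulr1.
  - by rewrite -[_ * s * _]mulrA (mulrA s s) ss mul1r -mulrA (mulrA (1 - p)) p2 mul1r.
  clear ss; clearbody s.
  rewrite !prodE mulrNN -opprD !mulrDl mulNr mulrDl mul1r -mulrA ps rs.
  rewrite !mulrDr mulr1 mulrA (sl p ep) (sl0 r er) mulNr opprD opprK.
  rewrite [- p + r]addrC.
  rewrite opprD addrACA subrr addr0.
  by rewrite opprB [s + _]addrC addrACA subrr addr0 addrC.
set t := p * q + q * p.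
have B1 : nilev t ('X * ('X^2 + 4)) by apply: B.
have {B}B2 : nilev t (8 * ('X * ('X^2 + 1))).
  have -> : 8 * ('X * ('X^2 + 1)) = ('X + 'X) * (('X + 'X) ^+ 2 + 4)
      :> {poly int} by ring.
  have := B (q + q); rewrite mulrDl mulrDr qe eq addr0 => /(_ erefl erefl).
  rewrite mulrDr mulrDl addrACA -/t.
  by rewrite /nilev !rmorphM !rmorphD !rmorphXn /= !rmorphD /= !evX !rmorph1.
have n24 : nilev t (24 * 'X).
  have -> : 24 * 'X = 8 * ('X * ('X^2 + 4)) - 8 * ('X * ('X^2 + 1))
      :> {poly int} by ring.
  by apply: nilevB => //; apply: nilevMl.
have n6 : nilev t (6 * 'X).
  apply: (@nilev_root _ _ _ 2).
  have -> : (6 * 'X) ^+ 3 = 24 * 'X * (9 * 'X^2) :> {poly int} by ring.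
  exact: nilevM.
have n4 : nilev t (4 * 'X).
  have -> : 4 * 'X = 'X * ('X + 2) * ('X + 4) - 'X * ('X^2 + 4) - 6 * 'X * 'X
      :> {poly int} by ring.
  by apply: nilevB; [apply: nilevB | apply: nilevM].
have nX : nilev t 'X.
  apply: (@nilev_root _ _ _ 2).
  have -> : 'X ^+ 3 = 'X * ('X^2 + 4) - 4 * 'X :> {poly int} by ring.
  exact: nilevB.
have cte : GRing.comm t e.
  by rewrite /GRing.comm /t mulrDl mulrDr -!mulrA pe qe !mulr0 !mulrA ep eq mul0r.
have -> : p * q = t * e.
  by rewrite /t mulrDl -!mulrA pe qe mulr0 addr0.
by apply: nil_mul_comm => //; move: nX; rewrite /nilev evX.
Qed.

(** By [corner_mul_nil] the right ideal generated by [e * x * (1 - e)] is nil. *)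
Lemma corner_radical e x : is_idempotent e -> radical (e * x * (1 - e)).
Proof.
move=> ee; set p := e * x * (1 - e).
have ff : (1 - e) * (1 - e) = 1 - e by apply: idem_compl.
have ef : e * (1 - e) = 0 by rewrite mulrBr mulr1 ee subrr.
have fe : (1 - e) * e = 0 by rewrite mulrBl mul1r ee subrr.
have ep : e * p = p by rewrite /p !mulrA ee.
have pf : p * (1 - e) = p by rewrite /p -!mulrA ff.
have np w : is_nilpotent (p * w).
  rewrite -ep -mulrA; apply: nil_swap.
  have -> : p * w * e = p * ((1 - e) * w * e) by rewrite !mulrA pf.
  apply: (corner_mul_nil ee) => //; first by rewrite /p -mulrA fe mulr0.
    by rewrite -(mulrA _ e e) ee.
  by rewrite !mulrA ef !mul0r.
move=> y z; apply: unit_1D_nil; rewrite -mulrA; apply: nil_swap.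
by rewrite -mulrA.
Qed.

Lemma idem_central_radical e x : is_idempotent e -> radical (x * e - e * x).
Proof.
move=> ee; have := corner_radical x ee; have := corner_radical x (idem_compl ee).
rewrite subKr => J1 J2.
have -> : x * e - e * x = (1 - e) * x * e - e * x * (1 - e).
  by rewrite !mulrBl mul1r mulrBr mulr1 opprB addrA subrK.
exact: radicalB.
Qed.

(** Comparing [(1 + j) ^+ 4] and [(1 - j) ^+ 4], both unipotent, gives
    [8 * j * (1 + j ^+ 2)] nilpotent, where the last factor is a unit.  Thus
    [2 * j] is nilpotent, and [(1 + j) ^+ 4 - 1] reduces to [j ^+ 4]. *)
Lemma radical_nil j : radical j -> is_nilpotent j.
Proof.
move=> Jj.
have n4 (p : {poly int}) : is_unit (ev j p) -> nilev j (p ^+ 4 - 1).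
  by move/unit_pow4; rewrite /nilev rmorphB rmorphXn rmorph1.
have nD : nilev j ((1 + 'X) ^+ 4 - 1).
  by apply: n4; rewrite rmorphD rmorph1 evX; apply: unit_1D_rad.
have nB : nilev j ((1 - 'X) ^+ 4 - 1).
  by apply: n4; rewrite rmorphB rmorph1 evX; apply: unit_1B_rad.
have n8 : nilev j (8 * 'X).
  apply: (@nilev_cancel _ _ _ (1 + 'X^2)).
    rewrite rmorphD rmorphXn rmorph1 /= evX expr2; apply: unit_1D_rad.
    exact: radicalMl.
  have -> : 8 * 'X * (1 + 'X^2) = ((1 + 'X) ^+ 4 - 1) - ((1 - 'X) ^+ 4 - 1)
      :> {poly int} by ring.
  exact: nilevB.
have n2 : nilev j (2 * 'X).
  apply: (@nilev_root _ _ _ 2).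
  have -> : (2 * 'X) ^+ 3 = 8 * 'X * 'X^2 :> {poly int} by ring.
  exact: nilevM.
suff : nilev j 'X by rewrite /nilev evX.
apply: (@nilev_root _ _ _ 3).
have -> : 'X ^+ 4 = ((1 + 'X) ^+ 4 - 1) - 2 * 'X * (2 + 3 * 'X + 2 * 'X^2)
      :> {poly int} by ring.
by apply: nilevB => //; apply: nilevM.
Qed.

(** The idempotent [g = 1 - y * x] satisfies [x * g = 0], hence [g * x], and with it
    [g = g * x * y], lies in J; and J contains no idempotent but 0. *)
Lemma hirano_dedekind x y : x * y = 1 -> y * x = 1.
Proof.
move=> xy.
have yxi : is_idempotent (y * x).
  by rewrite /is_idempotent mulrA -(mulrA y x y) xy mulr1.
set g := 1 - y * x; have gg : is_idempotent g by apply: idem_compl.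
have xg : x * g = 0 by rewrite mulrBr mulr1 mulrA xy mul1r subrr.
suff g0 : g = 0 by apply/esym/eqP; rewrite -subr_eq0 -/g g0.
apply: idem_radical_eq0 => //.
have := idem_central_radical x gg; rewrite xg sub0r => /radicalN; rewrite opprK.
by move=> /(@radicalMr _ _ y); rewrite -mulrA xy mulr1.
Qed.

(** When [e = a * r], the element [e * r + (1 - e)] is a right inverse modulo J,
    because [e] is central there; Dedekind-finiteness makes it two-sided. *)
Lemma corner_unit e a : is_idempotent e -> in_right_ideal a e ->
  is_unit (a * e + (1 - e)).
Proof.
move=> ee [r er].
have ef : e * (1 - e) = 0 by rewrite mulrBr mulr1 ee subrr.
have fe : (1 - e) * e = 0 by rewrite mulrBl mul1r ee subrr.
have ff : (1 - e) * (1 - e) = 1 - e by apply: idem_compl.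
have E : (a * e + (1 - e)) * (e * r + (1 - e)) = 1 + (a * e - e * a) * r.
  have eDf : e + (1 - e) = 1 by rewrite addrC subrK.
  move: (1 - e) eDf ef fe ff => f eDf ef fe ff.
  rewrite -eDf [in RHS]mulrBl -(mulrA e a) -er ee.
  rewrite mulrDl !mulrDr !mulrA fe mul0r add0r ff -(mulrA a e e) ee -(mulrA a e f) ef mulr0 addr0.
  by rewrite [RHS]addrC addrA subrK.
have /unit_1D_rad[w [vw _]] : radical ((a * e - e * a) * r).
  by apply: radicalMr; apply: idem_central_radical.
move: vw; rewrite -E -mulrA => vw.
by eexists; split; [exact: vw | apply: hirano_dedekind].
Qed.

(** * Exchange Hirano rings are Yaqub nil-clean *)

(** The exchange idempotent for [a] is one for [1 - a] after exchanging [e] and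
    [1 - e], which yields two units, one for each factor. *)
Lemma exchange_nil_pow4 a : exchange_ring R ->
  nilev a (('X^4 - 1) * ((1 - 'X) ^+ 4 - 1)).
Proof.
move=> /(_ a)[e [ee ae bf]].
set P := 'X^4 - 1; set Q := (1 - 'X) ^+ 4 - 1.
have ff := idem_compl ee.
have fe : (1 - e) * e = 0 by rewrite mulrBl mul1r ee subrr.
have [m vm] : nilev (a * e + (1 - e)) P.
  rewrite /nilev rmorphB rmorphXn rmorph1 /= evX.
  by apply: unit_pow4; apply: corner_unit.
have [n cn] : nilev (a * (1 - e)) Q.
  rewrite /nilev !(rmorphB, rmorphXn, rmorph1) /= evX; apply: unit_pow4.
  have := corner_unit ff bf.
  by rewrite mulrBl mul1r subKr addrAC subrK.
have Je : radical (ev a (P ^+ m) * e).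
  rewrite -[_ * e]opprK; apply: radicalN; rewrite -mulNr -[X in X * e]add0r.
  rewrite -[0](_ : ev (a * e + (1 - e)) (P ^+ m) = 0) ?rmorphXn //.
  rewrite -!rmorphXn; apply: ev_transfer; first exact: idem_central_radical.
  by rewrite mulrDl fe addr0 -mulrA ee.
have Jf : radical (ev a (Q ^+ n) * (1 - e)).
  rewrite -[_ * (1 - e)]opprK; apply: radicalN; rewrite -mulNr -[X in X * (1 - e)]add0r.
  rewrite -[0](_ : ev (a * (1 - e)) (Q ^+ n) = 0) ?rmorphXn //.
  rewrite -!rmorphXn; apply: ev_transfer; first exact: idem_central_radical.
  by rewrite -mulrA ff.
(* Split along 1 = e + (1 - e): each factor is killed, modulo J, on one corner. *)
have nPQ : nilev a (P ^+ m * Q ^+ n).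
  apply: radical_nil; rewrite -[ev _ _]mulr1 -[1](subrK e) mulrDr.
  apply: radicalD; first by rewrite rmorphM -mulrA; apply: radicalMl.
  by rewrite mulrC rmorphM -mulrA; apply: radicalMl.
apply: (@nilev_root _ _ _ (m + n)).
have -> : (P * Q) ^+ (m + n).+1 = P ^+ m * Q ^+ n * (P ^+ n * Q ^+ m * (P * Q)).
  by rewrite exprS exprD !exprMn; ring.
exact: nilevM.
Qed.

(** By [exchange_nil_pow4], with [y = a * (1 - a ^+ 4)],
    [y * (a ^+ 3 - 4 * a ^+ 2 + 6 * a - 4)] is nilpotent.  Multiplied by 15, it
    shows that [15 * y * a ^+ 3] is a multiple of 30 up to nilpotents, hence that
    [15 * y] is nilpotent.  Then [y] and [16 * y] agree up to nilpotents, and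
    [4 * y] agrees with a multiple of [y * a]: thus [y] is, up to nilpotents, a
    multiple of [y * a]. *)
Lemma hirano_exchange_pi_regular a : exchange_ring R ->
  exists2 h, GRing.comm a h & is_nilpotent (a * (1 - a * h)).
Proof.
move=> XR.
(* The value 80 * 15 of the polynomial at 3. *)
have n1200 : nilev a ((3 ^+ 4 - 1) * ((1 - 3) ^+ 4 - 1)).
  have := exchange_nil_pow4 3 XR.
  by rewrite /nilev !(rmorphM, rmorphB, rmorphXn, rmorph1) /= evX rmorph_nat.
have n30 : nilev a 30.
  apply: (@nilev_root _ _ _ 3).
  have -> : 30 ^+ 4 = (3 ^+ 4 - 1) * ((1 - 3) ^+ 4 - 1) * 675 :> {poly int} by ring.
  exact: nilevM.
have nK := exchange_nil_pow4 a XR.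
pose y : {poly int} := 'X * (1 - 'X^4).
have n15 : nilev a (15 * y).
  apply: (@nilev_root _ _ _ 1).
  have n15X : nilev a (15 * y * 'X).
    apply: (@nilev_root _ _ _ 2).
    have -> : (15 * y * 'X) ^+ 3 = (- 15 * (('X^4 - 1) * ((1 - 'X) ^+ 4 - 1))
       + 30 * (y * (2 * 'X^2 - 3 * 'X + 2))) * ((15 * y) ^+ 2) :> {poly int}.
      by rewrite /y; ring.
    by apply/nilevM/nilevD; [exact: nilevMl | exact: nilevM].
  have -> : (15 * y) ^+ 2 = (15 * y * 'X) * (15 * (1 - 'X^4)) :> {poly int} by rewrite /y; ring.
  exact: nilevM.
pose g : {poly int} := 4 * ('X^2 - 4 * 'X + 6).
pose H : {poly int} := 'X^3 + g - 'X^4 * g.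
exists (ev a H); first by apply: comm_ev; exact: commr_refl.
have : nilev a ('X * (1 - 'X * H)).
  have -> : 'X * (1 - 'X * H) = 4 * (('X^4 - 1) * ((1 - 'X) ^+ 4 - 1)) - 15 * y :> {poly int}.
    by rewrite /H /g /y; ring.
  by apply: nilevB => //; apply: nilevMl.
by rewrite /nilev !(rmorphM, rmorphB, rmorph1) /= !evX.
Qed.

Lemma hirano_exchange_yaqub : exchange_ring R -> yaqub_nil_clean R.
Proof.
move=> XR a; have [h cah nah] := hirano_exchange_pi_regular a XR.
have [e [b [ee cae [abe bae] [be eb] nf]]] := fitting cah nah.
have fe : (1 - e) * e = 0 by rewrite mulrBl mul1r ee subrr.
pose u := a * e + (1 - e).
have ef : e * (1 - e) = 0 by rewrite mulrBr mulr1 ee subrr.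
have ff : (1 - e) * (1 - e) = 1 - e by apply: idem_compl.
have bf : b * (1 - e) = 0 by rewrite mulrBr mulr1 be subrr.
have fb : (1 - e) * b = 0 by rewrite mulrBl mul1r eb subrr.
have caf : GRing.comm a (1 - e) by apply: commrB => //; exact: commr1.
have eDf : e + (1 - e) = 1 by rewrite addrC subrK.
have uU : is_unit u.
  rewrite /u; move: (1 - e) eDf ef fe ff bf fb caf => f eDf ef fe ff bf fb caf.
  exists (b + f); rewrite -eDf; split.
    by rewrite mulrDl !mulrDr -!mulrA ef eb abe fb ff mulr0 addr0 add0r.
  by rewrite mulrDl !mulrDr !mulrA bae ee bf addr0 -caf -(mulrA a) fe mulr0 add0r ff.
(* The sign of the Hirano alternative is the parameter s. *)
have step s : GRing.comm s a -> GRing.comm s e -> is_nilpotent (1 + s * u ^+ 2) ->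
    is_nilpotent (a + s * a ^+ 3).
  move=> csa cse nu.
  have caa : GRing.comm a a by exact: commr_refl.
  have cua : GRing.comm a u by rewrite /u; apply: commrD => //; apply: commrM.
  have ceu : GRing.comm e u.
    by rewrite /GRing.comm /u mulrDl mulrDr fe ef !addr0 mulrA -cae -mulrA ee.
  have csu : GRing.comm s u.
    by apply: commrD; [apply: commrM | apply: commrB => //; exact: commr1].
  have poly_comm x v : GRing.comm x s -> GRing.comm x v -> GRing.comm x (1 + s * v ^+ 2).
    by move=> cxs cxv; apply: commrD; [exact: commr1 | apply: commrM => //; exact: commrX].
  have aE : a + s * a ^+ 3 = (1 + s * a ^+ 2) * a by rewrite mulrDl mul1r -mulrA -exprSr.
  rewrite aE; apply: (nil_split ee).
  - by apply/commr_sym/commrM; [apply: poly_comm|]; exact/commr_sym.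
  - have -> : (1 + s * a ^+ 2) * a * e = (1 + s * u ^+ 2) * (a * e).
      have uae : u * (a * e) = a * (a * e).
        by rewrite /u mulrDl -(mulrA a) cae !(mulrA _ e a) ee fe mul0r addr0 mulrA.
      clearbody u.
      rewrite !expr2 -mulrA !mulrDl !mul1r -!mulrA uae.
      by rewrite (mulrA u) -cua -(mulrA a u) uae.
    apply: nil_mul_comm => //; apply/commr_sym/poly_comm; apply/commr_sym.
      exact: commrM.
    by apply: commrM; exact/commr_sym.
  have -> : (1 + s * a ^+ 2) * a * (1 - e) = a * (1 - e) * (1 + s * a ^+ 2).
    rewrite -mulrA; apply/commr_sym/poly_comm; apply/commr_sym.
      by apply: commrM => //; apply: commrB => //; exact: commr1.
    exact: commrM.
  apply: nil_mul_comm => //; apply: poly_comm; apply/commr_sym.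
    by apply: commrM => //; apply: commrB => //; exact: commr1.
  exact: commrM.
case: (HR uU) => nu; [left; have := step 1 | right; have := step (-1)].
  by rewrite !mul1r; apply=> //; apply/commr_sym/commr1.
by rewrite !mulN1r; apply=> //; apply/commr_sym/commrN1.
Qed.

End HiranoRings.

Theorem theorem5p4 (R : pzRingType) :
  yaqub_nil_clean R <-> (exchange_ring R /\ hirano_ring R).
Proof.
split=> [Y | [XR HR]].
  by split; [exact: yaqub_exchange | exact: yaqub_hirano].
have [R0 | R_nz] := eqVneq (1 : R) 0.
  by move=> a; left; exists 0; rewrite expr0.
(* Polynomial evaluation needs a nonzero ring. *)
pose S : nzRingType := HB.pack (GRing.PzRing.sort R) (GRing.PzRing.class R)
  (GRing.PzSemiRing_isNonZero.Build R R_nz).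
exact: (@hirano_exchange_yaqub S HR XR).
Qed.
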